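(* Let $q=p^m$ be an odd prime power. Then, for any $n\le q-2$ and $0\le r\le k-1$ (with $n,k,r$ integers): 1) if $n=2k+1$, there exists a linear code $C$ with parameters $[n=2k+1,k,\ge k+1]_{q^2}$ such that $0\le\dim \mathrm{Hull}_E(C)\le k-r-1$; and 2) if $k\le\lfloor n/2\rfloor-1$, there exists a linear code $C$ with parameters $[n,k,\ge n-k]_{q^2}$ such that $0\le\dim \mathrm{Hull}_E(C)\le k-r$.
   Context: An $[n,k,d]_{q^2}$ code is a linear code over $\mathbb{F}_{q^2}$ of length $n$, dimension $k$ and minimum Hamming distance $d$; $[n,k,\ge d_0]_{q^2}$ means that the minimum distance is at least $d_0$. The Euclidean inner product is $\langle x,y\rangle_E=\sum_i x_iy_i$, $C^{\perp_E}$ is the dual of $C$ with respect to it, and the Euclidean hull is $\mathrm{Hull}_E(C)=C\cap C^{\perp_E}$. *)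

(* Defs.v *)
From HB Require Import structures.
From mathcomp Require Import all_boot all_order all_algebra.

Set Implicit Arguments.
Unset Strict Implicit.
Unset Printing Implicit Defensive.

Import GRing.Theory.
Local Open Scope ring_scope.

Definition inner_E (F : finFieldType) (n : nat) (x y : 'rV[F]_n) : F :=
  \sum_(i < n) x 0 i * y 0 i.

Lemma inner_E_is_linear (F : finFieldType) (n : nat) (x : 'rV[F]_n) :
  linear (inner_E x : 'rV[F]_n -> F^o).
Proof.
move=> a u v; rewrite /inner_E scaler_sumr -big_split; apply: eq_bigr => i _ /=.
by rewrite !mxE mulrDr mulrCA.
Qed.

HB.instance Definition _ (F : finFieldType) (n : nat) (x : 'rV[F]_n) :=
  GRing.isLinear.Build F 'rV[F]_n F^o _ (inner_E x : 'rV[F]_n -> F^o)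
    (inner_E_is_linear x).

Definition dual_E (F : finFieldType) (n : nat) (C : {vspace 'rV[F]_n}) :
    {vspace 'rV[F]_n} :=
  (\bigcap_(c : 'rV[F]_n | c \in C)
     lker (linfun (inner_E c : 'rV[F]_n -> F^o)))%VS.

Lemma mem_dual_E (F : finFieldType) (n : nat) (C : {vspace 'rV[F]_n})
    (x : 'rV[F]_n) :
  reflect (forall c, c \in C -> inner_E c x = 0) (x \in dual_E C).
Proof.
rewrite memvE; apply: (iffP subv_bigcapP) => h c /h.
  by rewrite -memvE memv_ker lfunE => /eqP.
by move=> e; rewrite -memvE memv_ker lfunE; apply/eqP.
Qed.

Definition hull_E (F : finFieldType) (n : nat) (C : {vspace 'rV[F]_n}) :
    {vspace 'rV[F]_n} := (C :&: dual_E C)%VS.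

Definition hamming_dist (F : finFieldType) (n : nat) (x y : 'rV[F]_n) : nat :=
  #|[set i : 'I_n | x 0 i != y 0 i]|.

(* Hamming distances never exceed [n], so the default value [n] does not affect
   the minimum, except for the zero code, whose distance is [n] by convention. *)
Definition min_dist (F : finFieldType) (n : nat) (C : {vspace 'rV[F]_n}) : nat :=
  \big[minn/n]_(xy : 'rV[F]_n * 'rV[F]_n |
      [&& xy.1 \in C, xy.2 \in C & xy.1 != xy.2])
    hamming_dist xy.1 xy.2.

(* An [n, k, >= d0] code over [F]; the length [n] is carried by the type. *)
Definition is_code_ge (F : finFieldType) (n k d0 : nat)
    (C : {vspace 'rV[F]_n}) : Prop :=
  \dim C = k /\ (d0 <= min_dist C)%N.

(* Main.v *)
(* Reed-Solomon codes are MDS, and stay so when coordinates are multiplied by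
   nonzero scalars. Multiply the first k coordinates by c: if [V1 | V2] is the
   Vandermonde generator matrix, with V1 square and invertible, the Gram matrix
   becomes c^2 V1 V1^T + V2 V2^T, whose determinant is a nonzero polynomial of
   degree 2k in c. As 2k + 1 < q^2, some nonzero c is not a root, and the
   resulting code has trivial hull, whatever r is. *)
Require Import Defs.
From HB Require Import structures.
From mathcomp Require Import all_boot all_order all_algebra.
From mathcomp Require Import zify.

Set Implicit Arguments.
Unset Strict Implicit.
Unset Printing Implicit Defensive.

Import GRing.Theory.
Local Open Scope ring_scope.

(** The bound [d <= n] handles the default value [n] of the minimum. *)
Lemma leq_min_dist (F : finFieldType) (n d : nat) (C : {vspace 'rV[F]_n}) :
  (d <= n)%N ->
  (forall x y, x \in C -> y \in C -> x != y -> (d <= hamming_dist x y)%N) ->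
  (d <= min_dist C)%N.
Proof.
move=> le_dn le_dC; rewrite /min_dist.
apply: (big_ind (leq d)) => // [a b da db|xy /and3P[xC yC ne_xy]]; last exact: le_dC.
by rewrite leq_min da db.
Qed.

Definition row_code (F : finFieldType) (k n : nat) (G : 'M[F]_(k, n)) :
    {vspace 'rV[F]_n} := limg (linfun (mulmxr G : 'rV[F]_k -> 'rV[F]_n)).

Lemma row_codeP (F : finFieldType) (k n : nat) (G : 'M[F]_(k, n))
    (x : 'rV[F]_n) :
  reflect (exists u : 'rV_k, x = u *m G) (x \in row_code G).
Proof.
apply: (iffP memv_imgP) => [[u _ ->]|[u ->]]; exists u; rewrite ?memvf //.
  by rewrite lfunE.
by rewrite lfunE.
Qed.

(** An invertible Gram matrix makes [u |-> u *m G] injective: [u *m G = 0] gives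
    [u *m (G *m G^T) = 0], so [u = 0]. *)
Lemma dim_row_code (F : finFieldType) (k n : nat) (G : 'M[F]_(k, n)) :
  G *m G^T \in unitmx -> \dim (row_code G) = k.
Proof.
move=> gramG; rewrite limg_dim_eq ?dimvf ?/dim /= ?mul1n //.
apply/eqP; rewrite -subv0; apply/subvP => u.
rewrite memv_cap memv_ker lfunE memv0 => /andP[_ /eqP/= uG0].
by rewrite -(mulmxK gramG u) mulmxA uG0 !mul0mx.
Qed.

(** If [u *m G] is orthogonal to every row of [G], then [u *m (G *m G^T) = 0], so [u = 0]. *)
Lemma hull_row_code (F : finFieldType) (k n : nat) (G : 'M[F]_(k, n)) :
  G *m G^T \in unitmx -> hull_E (row_code G) = 0%VS.
Proof.
move=> gramG; apply/eqP; rewrite -subv0; apply/subvP => x.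
rewrite memv_cap memv0 => /andP[/row_codeP[u ->] /mem_dual_E dual_uG].
suff u0 : u *m (G *m G^T) = 0 by rewrite -(mulmxK gramG u) u0 !mul0mx.
apply/rowP => i; rewrite mulmxA [LHS]mxE [RHS]mxE.
have row_iG : row i G \in row_code G.
  by apply/row_codeP; exists (delta_mx 0 i); rewrite rowE.
rewrite -[RHS](dual_uG _ row_iG) /inner_E.
by apply: eq_bigr => j _; rewrite [row i G 0 j]mxE [G^T j i]mxE mulrC.
Qed.

Lemma horner_rVpoly_Vandermonde (R : comNzRingType) (k n : nat)
    (a : 'rV[R]_n) (u : 'rV[R]_k) (j : 'I_n) :
  (rVpoly u).[a 0 j] = (u *m Vandermonde k a) 0 j.
Proof.
rewrite horner_poly mxE; apply: eq_bigr => i _.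
by rewrite valK mxE.
Qed.

(** Two codewords agree at [j] exactly when the difference of their message polynomials vanishes at
    [a 0 j]. That difference is nonzero of degree below [k], so it has fewer than [k] roots. *)
Lemma min_dist_GRS (F : finFieldType) (k n : nat) (a v : 'rV[F]_n) :
  injective (a 0) -> (forall j, v 0 j != 0) -> (0 < k <= n)%N ->
  ((n - k).+1 <= min_dist (row_code (Vandermonde k a *m diag_mx v)))%N.
Proof.
move=> inj_a v_neq0 /andP[k_gt0 le_kn]; apply: leq_min_dist; first by lia.
move=> _ _ /row_codeP[x ->] /row_codeP[y ->] ne_xy.
pose p := rVpoly (x - y).
have p_neq0 : p != 0.
  apply: contraNneq ne_xy => p0; rewrite -subr_eq0 -mulmxBl.
  by rewrite -[x - y]rVpolyK -/p p0 linear0 mul0mx.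
have hdist : hamming_dist (x *m (Vandermonde k a *m diag_mx v))
    (y *m (Vandermonde k a *m diag_mx v)) = #|~: [set j | root p (a 0 j)]|.
  apply: eq_card => j; rewrite !inE -subr_eq0 rootE horner_rVpoly_Vandermonde.
  rewrite !mulmxA !mul_mx_diag mulmxBl !mxE -mulrBl mulf_eq0.
  by rewrite (negPf (v_neq0 j)) orbF.
have roots_p : (#|[set j | root p (a 0%R j)]| < k)%N.
  apply: leq_trans (size_poly k _); rewrite -/p cardE -(size_map (a 0)).
  apply: max_poly_roots p_neq0 _ _.
    by apply/allP => _ /mapP[j + ->]; rewrite mem_enum inE.
  by rewrite map_inj_uniq ?enum_uniq.
rewrite hdist cardsCs setCK card_ord; lia.
Qed.

Lemma unitmx_Vandermonde (F : fieldType) (n : nat) (a : 'rV[F]_n) :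
  injective (a 0) -> Vandermonde n a \in unitmx.
Proof.
move=> inj_a; rewrite unitmxE det_Vandermonde unitfE.
apply/prodf_neq0 => i _; apply/prodf_neq0 => j lt_ij.
rewrite subr_eq0; apply: contraTneq lt_ij => /inj_a ->.
by rewrite ltnn.
Qed.

(** With [A = - P^-1 Q], one has [c^2 P + Q = - P (A - c^2 I)], which is singular exactly when [c^2]
    is an eigenvalue of [A]. *)
Lemma exists_scale_unitmx (F : finFieldType) (k : nat) (P Q : 'M[F]_k) :
  P \in unitmx -> (2 * k + 1 < #|F|)%N ->
  exists2 c : F, c != 0 & c ^+ 2 *: P + Q \in unitmx.
Proof.
move=> unitP lt_kF; pose A := - (invmx P *m Q).
(* The factor ['X] makes 0 a root, so every non-root is nonzero. One exists since the degree is
   [2 * k + 1 < #|F|]. *)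
pose p := (char_poly A \Po 'X^2) * 'X.
have sz_comp : size (char_poly A \Po 'X^2) = (2 * k).+1.
  have comp_neq0 : char_poly A \Po 'X^2 != 0.
    rewrite comp_poly_eq0 ?size_polyXn //.
    by rewrite monic_neq0 ?char_poly_monic.
  (* This gives only the predecessor of the size; nonvanishing recovers the size. *)
  have := size_comp_poly (char_poly A) 'X^2.
  rewrite size_char_poly size_polyXn /=.
  move: comp_neq0; rewrite -size_poly_gt0.
  by case: (size _) => //= s _ ->; rewrite mulnC.
have p_neq0 : p != 0.
  by rewrite mulf_neq0 ?polyX_eq0 // -size_poly_gt0 sz_comp.
have [c pc_neq0] : exists c, ~~ root p c.
  apply/existsP; rewrite -negb_forall; apply: contraL lt_kF => /forallP root_p.
  have := max_poly_roots p_neq0 (rs := enum F) _ (enum_uniq _).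
  rewrite -cardE size_mulX -?size_poly_gt0 sz_comp // => le_F.
  by rewrite -leqNgt addn1; apply/le_F/allP.
move: pc_neq0; rewrite rootM rootX negb_or => /andP[root_c c_neq0].
exists c => //.
have -> : c ^+ 2 *: P + Q = - P *m (A - (c ^+ 2)%:M).
  rewrite mulmxBr mul_mx_scalar mulNmx mulmxN opprK mulKVmx //.
  by rewrite scalerN opprK addrC.
have := root_c; rewrite rootE horner_comp hornerXn -rootE.
rewrite -eigenvalue_root_char negbK kermx_eq0 row_free_unit => unitA.
by rewrite unitmx_mul -scaleN1r unitmxZ ?unitrN1 ?unitP.
Qed.

Lemma exists_LCD_MDS (F : finFieldType) (n k : nat) :
  (0 < k <= n)%N -> (n <= #|F|)%N -> (2 * k + 1 < #|F|)%N ->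
  exists C : {vspace 'rV[F]_n},
    is_code_ge k (n - k).+1 C /\ hull_E C = 0%VS.
Proof.
move=> /[dup] k_bounds /andP[k_gt0 le_kn].
(* Writing [n] as [k + l] lets the generator matrix split into a square block and a remainder. *)
move: k_bounds; rewrite -(subnKC le_kn); move: (n - k)%N => l.
move=> k_bounds le_nF lt_kF.
(* The evaluation points are the first [k + l] elements in the enumeration of [F]. *)
pose a : 'rV[F]_(k + l) := \row_j enum_val (widen_ord le_nF j).
have inj_a : injective (a 0).
  by move=> i j; rewrite !mxE => /enum_val_inj[] /val_inj.
pose V1 := Vandermonde k (lsubmx a); pose V2 := Vandermonde k (rsubmx a).
have unitV1 : V1 *m V1^T \in unitmx.
  rewrite unitmx_mul unitmx_tr andbb unitmx_Vandermonde // => i j.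
  by rewrite !mxE => /enum_val_inj[] /val_inj.
have [c c_neq0 unit_gram] := exists_scale_unitmx (V2 *m V2^T) unitV1 lt_kF.
pose v : 'rV[F]_(k + l) := row_mx (const_mx c) (const_mx 1).
have v_neq0 j : v 0 j != 0.
  by rewrite mxE; case: split => i; rewrite mxE ?oner_neq0.
pose G := Vandermonde k a *m diag_mx v.
have GE : G = row_mx (c *: V1) V2.
  apply/matrixP => i j; rewrite /G mul_mx_diag !mxE.
  case: splitP => s eq_js; rewrite !mxE.
    rewrite mulrC; congr (_ * enum_val _ ^+ _); exact: val_inj.
  rewrite mulr1; congr (enum_val _ ^+ _); exact: val_inj.
have gramG : G *m G^T \in unitmx.
  rewrite GE tr_row_mx mul_row_col linearZ /= -scalemxAl -scalemxAr scalerA.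
  by rewrite -expr2.
exists (row_code G); split; last exact: hull_row_code.
by split; [exact: dim_row_code | exact: min_dist_GRS].
Qed.

Theorem theorem2 (p m q : nat) (F : finFieldType) (n k r : nat)
    (p_prime : prime p) (m_gt0 : (0 < m)%N) (q_def : q = (p ^ m)%N)
    (q_odd : odd q) (card_F : #|F| = (q ^ 2)%N)
    (n_le : (n <= q - 2)%N) (r_ge0 : (0 <= r)%N) (r_lt : (r < k)%N) :
  (n = (2 * k + 1)%N ->
     exists C : {vspace 'rV[F]_n},
       is_code_ge k (k + 1) C /\ (0 <= \dim (hull_E C) <= k - r - 1)%N)
  /\
  ((k <= n./2 - 1)%N ->
     exists C : {vspace 'rV[F]_n},
       is_code_ge k (n - k) C /\ (0 <= \dim (hull_E C) <= k - r)%N).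
Proof.
have exC : (k <= n)%N -> exists C : {vspace 'rV[F]_n},
    is_code_ge k (n - k).+1 C /\ hull_E C = 0%VS.
  (* Since [0 <= r < k <= n <= q - 2], both [n <= q^2] and [2 * k + 1 <= 2 * q - 3 < q^2] hold. *)
  by move=> le_kn; apply: exists_LCD_MDS; rewrite ?card_F; nia.
split=> [n_eq|k_le].
  (* For [n = 2 * k + 1] the distance bound [n - k + 1] equals [k + 2]. *)
  have [|C [[dimC dC] hullC]] := exC; first by lia.
  exists C; rewrite hullC dimv0; split=> //; split=> //; lia.
have [|C [[dimC dC] hullC]] := exC; first by lia.
by exists C; rewrite hullC dimv0; split=> //; split=> //; apply: ltnW.
Qed.
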